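(* Let $G$ be an abelian group and $\phi\in\mathrm{End}(G)$. Then $h(\phi)=0$ if and only if $\phi$ has polynomial growth. Consequently, $h(\phi)>0$ if and only if there exists a non-empty finite subset $F$ of $G$ such that $\phi$ does not have polynomial growth with respect to $F$.
   Context: $\mathbb N_+=\{1,2,\dots\}$. For a non-empty finite subset $F$ of $G$ and $n\in\mathbb N_+$ put $T_n(\phi,F)=F+\phi(F)+\dots+\phi^{n-1}(F)$ and $\tau_{\phi,F}(n)=|T_n(\phi,F)|$. The limit $H(\phi,F)=\lim_{n\to\infty}\frac{\log\tau_{\phi,F}(n)}{n}$ exists, and the algebraic entropy of $\phi$ is $h(\phi)=\sup_F H(\phi,F)$, where $F$ ranges over all non-empty finite subsets of $G$. $\phi$ has polynomial growth with respect to $F$ if there is $P_F(x)\in\mathbb Z[x]$ with $\tau_{\phi,F}(n)\le P_F(n)$ for every $n\in\mathbb N_+$; $\phi$ has polynomial growth if this holds for every non-empty finite subset $F$ of $G$. *)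

(* Defs.v *)
From HB Require Import structures.
From mathcomp Require Import all_boot all_order all_algebra.
From mathcomp Require Import finmap.
From mathcomp Require Import all_classical all_reals all_analysis.

Set Implicit Arguments.
Unset Strict Implicit.
Unset Printing Implicit Defensive.

Import Order.TTheory GRing.Theory Num.Theory.
Import numFieldNormedType.Exports.

Local Open Scope fset_scope.
Local Open Scope classical_set_scope.
Local Open Scope ring_scope.

Definition sumset (G : zmodType) (A B : {fset G}) : {fset G} :=
  [fset a + b | a in A, b in B].

(* [fset 0] is neutral for sumset, so for n > 0 this is
   F + phi(F) + ... + phi^(n-1)(F) with no extra term; T_0 = {0}. *)
Definition trajectory (G : zmodType) (phi : {additive G -> G})
    (F : {fset G}) (n : nat) : {fset G} :=
  \big[@sumset G/[fset 0]]_(i < n) [fset iter i phi x | x in F].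

Definition tau (G : zmodType) (phi : {additive G -> G})
    (F : {fset G}) (n : nat) : nat :=
  #|` trajectory phi F n|.

(* The limit exists in R by Fekete's lemma, tau being submultiplicative with
   tau n <= |F|^n, so limn does not take its default value here.
   The term of index 0 is ln 1 / 0 = 0 and does not affect the limit. *)
Definition entropy_wrt (R : realType) (G : zmodType)
    (phi : {additive G -> G}) (F : {fset G}) : R :=
  limn (fun n : nat => ln ((tau phi F n)%:R : R) / n%:R).

(* The supremum is taken in the extended reals: h(phi) may be +oo. *)
Definition entropy (R : realType) (G : zmodType)
    (phi : {additive G -> G}) : \bar R :=
  ereal_sup [set (entropy_wrt R phi F)%:E | F in [set F : {fset G} | F != fset0]].

Definition poly_growth_wrt (G : zmodType) (phi : {additive G -> G})
    (F : {fset G}) : Prop :=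
  exists P : {poly int},
    forall n : nat, (0 < n)%N -> (tau phi F n)%:Z <= P.[n%:Z].

Definition poly_growth (G : zmodType) (phi : {additive G -> G}) : Prop :=
  forall F : {fset G}, F != fset0 -> poly_growth_wrt phi F.

(* Main.v *)
Require Import Defs.
From HB Require Import structures.
From mathcomp Require Import all_boot all_order all_algebra algC.
From mathcomp Require Import finmap.
From mathcomp Require Import all_classical all_reals all_analysis.
From mathcomp Require Import zify ring.

Set Implicit Arguments.
Unset Strict Implicit.
Unset Printing Implicit Defensive.

Import Order.TTheory GRing.Theory Num.Theory.
Import numFieldNormedType.Exports.

Local Open Scope fset_scope.
Local Open Scope classical_set_scope.
Local Open Scope ring_scope.

(** View G as a module over the polynomial ring of the integers, X acting as
    phi.  For F = {0, g} the trajectory T_n consists of the q(phi)(g) with q of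
    degree < n and coefficients 0 or 1, and every finite set lies in a finite sum
    of such pairs; since T_n (A + B) = T_n A + T_n B, polynomial growth of all
    the pairs gives polynomial growth of phi.  That polynomial growth implies
    zero entropy is the fact that ln n / n tends to 0.

    Suppose h(phi) = 0 and fix g.  For each k > 0, the 2^m sums of the
    phi^(k i)(g) over sets of indices i < m cannot be distinct for all m, as
    this would force 2^m <= tau(k m) <= tau(m)^k and an entropy of at least
    ln 2 / k.  A coincidence is a nonzero polynomial f_k with coefficients in
    {-1, 0, 1} such that f_k(X^k) annihilates g ([small_relation]).  For k = 1
    it has leading coefficient 1 or -1.

    Let r be a nonzero annihilator of g of minimal degree and p its primitive
    part.  By
    Gauss's lemma p divides every annihilator ([ideal_primitive_divisor]), in
    particular f_1, so its leading coefficient is a unit.  A complex root z of p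
    is a root of every f_k(X^k); as the roots of a nonzero polynomial with
    coefficients in {-1, 0, 1} have modulus < 2, one has |z|^k < 2 for all k,
    hence |z| <= 1.  Therefore the remainders of the X^i modulo p, which satisfy
    a linear recurrence with these characteristic roots, have coefficients that
    grow polynomially in i ([linear_recurrence_growth]).

    So an element q(phi)(g) of T_n is determined by the remainder of q modulo p,
    for which there are polynomially many choices, and by an element of the
    finite module (p) / (r, f_1).  This bounds tau polynomially
    ([poly_bounded_pair]). *)

(** * Trajectories and their cardinality *)

Section Trajectories.
Variables (G : zmodType) (phi : {additive G -> G}).
Implicit Types (A B F : {fset G}) (x y : G) (m n : nat).

Lemma sumsetP A B x :
  reflect (exists a b, [/\ a \in A, b \in B & x = a + b]) (x \in sumset A B).
Proof.
apply: (iffP idP).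
  by case/imfset2P => a /= aA [b /= bB ->]; exists a, b.
by case=> a [b [aA bB ->]]; apply/imfset2P; exists a => //; exists b.
Qed.

Lemma card_sumset A B : (#|` sumset A B| <= #|` A| * #|` B|)%N.
Proof.
have sub : {subset sumset A B <= [seq a + b | a <- A, b <- B]}.
  by move=> x /sumsetP[a [b [aA bB ->]]]; apply/allpairsP; exists (a, b).
by apply: leq_trans (uniq_leq_size (fset_uniq _) sub) _; rewrite size_allpairs.
Qed.

Lemma trajectory0 F : trajectory phi F 0 = [fset 0].
Proof. by rewrite /trajectory big_ord0. Qed.

(** Peeling off the first summand, rather than the last, leaves a uniform image
    under phi: this is a Horner scheme for the trajectory. *)
Lemma trajectoryS F n :
  trajectory phi F n.+1 = sumset F [fset phi x | x in trajectory phi F n].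
Proof.
rewrite /trajectory big_ord_recl /=; congr sumset; first exact: imfset_id.
have morS : {morph (fun A : {fset G} => [fset phi x | x in A]) :
     A B / sumset A B >-> sumset A B}.
  move=> A B; apply/fsetP => z; apply/imfsetP/sumsetP.
    move=> [x /= /sumsetP[a [b [aA bB ->]]] ->]; rewrite raddfD.
    by exists (phi a), (phi b); split => //; apply: in_imfset.
  move=> [a' [b' [/imfsetP[a /= aA ->] /imfsetP[b /= bB ->] ->]]].
  by exists (a + b); [apply/sumsetP; exists a, b | rewrite raddfD].
rewrite (big_morph _ morS (id1 := [fset 0])); last first.
  by rewrite imfset_fset1 raddf0.
by apply: eq_bigr => i _; rewrite -imfset_comp; apply: eq_imfset.
Qed.

Lemma mem_trajectory F n x :
  x \in trajectory phi F n <->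
  exists2 c : nat -> G, (forall i, (i < n)%N -> c i \in F) &
    x = \sum_(i < n) iter i phi (c i).
Proof.
elim: n x => [|n IHn] x.
  rewrite trajectory0 inE; split=> [/eqP->|[c _ ->]]; last by rewrite big_ord0.
  by exists (fun=> 0) => //; rewrite big_ord0.
rewrite trajectoryS; split.
  case/sumsetP=> a [_ [aF /imfsetP[y /= /IHn[c cF ->] ->] ->]].
  exists (fun i => if i is i'.+1 then c i' else a); first by case.
  by rewrite big_ord_recl raddf_sum.
case=> c cF ->; apply/sumsetP.
exists (c 0%N), (phi (\sum_(i < n) iter i phi (c i.+1))); split.
- exact: cF.
- apply: in_imfset; apply/IHn; exists (fun i => c i.+1) => // i lt_in.
  exact: cF.
- by rewrite big_ord_recl raddf_sum.
Qed.

Lemma iter_raddf0 i : iter i phi 0 = 0.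
Proof. by elim: i => //= i ->; rewrite raddf0. Qed.

Lemma iter_raddfD i x y : iter i phi (x + y) = iter i phi x + iter i phi y.
Proof. by elim: i => //= i ->; rewrite raddfD. Qed.

Lemma sub_trajectory A B n : {subset A <= B} ->
  {subset trajectory phi A n <= trajectory phi B n}.
Proof.
move=> sAB x /mem_trajectory[c cA ->]; apply/mem_trajectory.
by exists c => // i lt_in; apply/sAB/cA.
Qed.

Lemma leq_tau A B n : {subset A <= B} -> (tau phi A n <= tau phi B n)%N.
Proof. by move=> sAB; apply/fsubset_leq_card/fsubsetP/sub_trajectory. Qed.

Lemma tau_sumset A B n :
  (tau phi (sumset A B) n <= tau phi A n * tau phi B n)%N.
Proof.
apply: leq_trans _ (card_sumset _ _).
apply/fsubset_leq_card/fsubsetP => x /mem_trajectory[c cAB ->].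
have /choice[d dP] : forall i, exists ab : G * G, (i < n)%N ->
    [/\ ab.1 \in A, ab.2 \in B & c i = ab.1 + ab.2].
  move=> i; have [lt_in|] := boolP (i < n)%N; last by exists (0, 0).
  by have /sumsetP[a [b abP]] := cAB i lt_in; exists (a, b).
apply/sumsetP; exists (\sum_(i < n) iter i phi (d i).1).
exists (\sum_(i < n) iter i phi (d i).2); split.
- by apply/mem_trajectory; exists (fun i => (d i).1) => // i /dP[].
- by apply/mem_trajectory; exists (fun i => (d i).2) => // i /dP[].
- rewrite -big_split; apply: eq_bigr => i _ /=.
  by case: (dP i) => // _ _ ->; rewrite iter_raddfD.
Qed.

(** T_(m+n) = T_m + phi^m (T_n), and phi^m cannot increase cardinality. *)
Lemma tau_submul F m n : (tau phi F (m + n) <= tau phi F m * tau phi F n)%N.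
Proof.
have /fsubsetP/fsubset_leq_card sub : {subset trajectory phi F (m + n) <=
  sumset (trajectory phi F m) [fset iter m phi x | x in trajectory phi F n]}.
  move=> x /mem_trajectory[c cF ->]; apply/sumsetP.
  exists (\sum_(i < m) iter i phi (c i)).
  exists (\sum_(i < n) iter (m + i) phi (c (m + i)%N)); split.
  - by apply/mem_trajectory; exists c => // i lt_im; apply/cF/ltn_addr.
  - apply/imfsetP; exists (\sum_(i < n) iter i phi (c (m + i)%N)) => /=.
      apply/mem_trajectory; exists (fun i => c (m + i)%N) => // i lt_in.
      by apply: cF; rewrite ltn_add2l.
    rewrite (big_morph _ (iter_raddfD m) (iter_raddf0 m)).
    by apply: eq_bigr => i _; rewrite iterD.
  - by rewrite big_split_ord.
apply: leq_trans sub _.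
apply: leq_trans (card_sumset _ _) _.
by rewrite leq_mul2l leq_imfset_card orbT.
Qed.

Lemma tau0 F : tau phi F 0 = 1%N.
Proof. by rewrite /tau trajectory0 cardfs1. Qed.

Lemma tau_exp F m k : (tau phi F (k * m) <= tau phi F m ^ k)%N.
Proof.
elim: k => [|k IHk]; first by rewrite mul0n tau0.
rewrite mulSn expnS; apply: leq_trans (tau_submul _ _ _) _.
by rewrite leq_mul2l IHk orbT.
Qed.

Lemma tau_gt0 F n : F != fset0 -> (0 < tau phi F n)%N.
Proof.
case/fset0Pn => g gF; rewrite cardfs_gt0; apply/fset0Pn.
exists (\sum_(i < n) iter i phi g).
by apply/mem_trajectory; exists (fun=> g).
Qed.

End Trajectories.

(** * The action of integer polynomials *)

Section PolynomialAction.
Variables (G : zmodType) (phi : {additive G -> G}).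
Implicit Types (g x : G) (n : nat) (p q : {poly int}).

(** The structure of module over the integer polynomials that phi gives to G,
    with the element as first argument so that [poly_act g] is additive. *)
Definition poly_act g (q : {poly int}) : G :=
  \sum_(i < size q) iter i phi g *~ q`_i.

Lemma poly_act_widen n g q : (size q <= n)%N ->
  poly_act g q = \sum_(i < n) iter i phi g *~ q`_i.
Proof.
move=> le_qn.
rewrite /poly_act (big_ord_widen n (fun i => iter i phi g *~ q`_i)) //.
rewrite big_mkcond; apply: eq_bigr => i _; case: ltnP => // le_qi.
by rewrite nth_default ?mulr0z.
Qed.

Lemma poly_act_is_zmod_morphism g : zmod_morphism (poly_act g).
Proof.
move=> p q; pose n := maxn (size p) (size q).
have szB : (size (p - q)%R <= n)%N.
  by rewrite (leq_trans (size_polyD _ _)) ?size_polyN.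
have [szp szq] : (size p <= n)%N /\ (size q <= n)%N by rewrite leq_maxl leq_maxr.
rewrite (poly_act_widen _ szB) (poly_act_widen _ szp) (poly_act_widen _ szq).
rewrite -sumrB; apply: eq_bigr => i _.
by rewrite coefB mulrzBr.
Qed.
HB.instance Definition _ g :=
  GRing.isZmodMorphism.Build {poly int} G (poly_act g)
    (poly_act_is_zmod_morphism g).

Lemma poly_actD p q g : poly_act g (p + q) = poly_act g p + poly_act g q.
Proof. exact: (raddfD (poly_act g)). Qed.

Lemma poly_actB p q g : poly_act g (p - q) = poly_act g p - poly_act g q.
Proof. exact: (raddfB (poly_act g)). Qed.

Lemma poly_actMX q g : poly_act g (q * 'X) = phi (poly_act g q).
Proof.
rewrite (@poly_act_widen (size q).+1); last first.
  by apply: leq_trans (size_polyMleq _ _) _; rewrite size_polyX addn2.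
rewrite big_ord_recl coefMX mulr0z add0r raddf_sum; apply: eq_bigr => i _.
by rewrite coefMX /= raddfMz.
Qed.

Lemma poly_actZ c q g : poly_act g (c *: q) = poly_act g q *~ c.
Proof.
by rewrite -[c]intz scaler_int (raddfMz (poly_act g)) intz.
Qed.

Lemma poly_act_ann p q g : poly_act g p = 0 -> poly_act g (q * p) = 0.
Proof.
move=> pg0; elim/poly_ind: q => [|q c IHq]; first by rewrite mul0r raddf0.
rewrite mulrDl poly_actD mulrAC poly_actMX IHq raddf0 add0r.
by rewrite mul_polyC poly_actZ pg0 mul0rz.
Qed.

Definition bit_poly (q : {poly int}) := forall i, q`_i = 0 \/ q`_i = 1.

(** A sequence of elements of {0, g} is g times a sequence of bits, which are the
    coefficients of the polynomial. *)
Lemma mem_trajectory_pair g n x :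
  x \in trajectory phi [fset 0; g] n <->
  exists q, [/\ bit_poly q, (size q <= n)%N & x = poly_act g q].
Proof.
split.
  move=> /mem_trajectory[c cF ->].
  exists (\poly_(i < n) (c i != 0)%:Z); split.
  - move=> i; rewrite coef_poly; case: ifP => _; last by left.
    by case: (c i != 0); [right | left].
  - exact: size_poly.
  - rewrite (poly_act_widen _ (size_poly _ _)); apply: eq_bigr => i _.
    rewrite coef_poly ltn_ord; have := cF i (ltn_ord i).
    rewrite !inE; case: (eqVneq (c i) 0) => [-> _|_ /= /eqP ->].
      by rewrite iter_raddf0 mulr0z.
    by rewrite mulr1z.
case=> q [q01 le_qn ->]; apply/mem_trajectory.
exists (fun i => g *~ q`_i) => [i _|].
  by rewrite !inE; case: (q01 i) => ->; rewrite ?mulr0z ?mulr1z eqxx ?orbT.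
rewrite (poly_act_widen _ le_qn); apply: eq_bigr => i _.
by case: (q01 i) => ->; rewrite ?mulr0z ?mulr1z ?iter_raddf0.
Qed.

End PolynomialAction.

(** * Polynomials with small integer coefficients *)

Definition small_poly (f : {poly int}) := forall i, `|f`_i| <= 1.

(** If |z| >= 2, the leading term, of modulus |z|^m, dominates the others, whose
    moduli sum to at most 1 + |z| + ... + |z|^(m-1) < |z|^m. *)
Lemma norm_root_small_poly (f : {poly int}) (z : algC) :
  f != 0 -> small_poly f -> root (map_poly intr f) z -> `|z| < 2.
Proof.
move=> f_neq0 f_small /rootP fz0; rewrite real_ltNge ?normr_real ?realn //.
apply/negP => z_ge2; pose m := (size f).-1.
have geo n : \sum_(i < n) `|z| ^+ i < `|z| ^+ n.
  elim: n => [|n IHn]; first by rewrite big_ord0 expr0.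
  rewrite big_ord_recr /=; apply: lt_le_trans (_ : 2 * `|z| ^+ n <= _).
    by rewrite mulr_natl mulr2n ltrD2r.
  by rewrite exprS ler_wpM2r // exprn_ge0.
have coef_le i : `|(f`_i)%:~R| <= 1 :> algC.
  by rewrite -intr_norm lerz1.
have lead1 : `|(f`_m)%:~R| = 1 :> algC.
  rewrite -intr_norm; suff -> : `|f`_m| = 1 by [].
  apply/eqP; rewrite eq_le f_small -gtz0_ge1 normr_gt0.
  by rewrite -lead_coefE lead_coef_eq0.
have size_f : (size (map_poly intr f : {poly algC}) <= m.+1)%N.
  by rewrite prednK ?size_poly_gt0 // size_poly.
have zm_eq : (f`_m)%:~R * z ^+ m = - \sum_(i < m) (f`_i)%:~R * z ^+ i.
  apply/eqP; rewrite -addr_eq0 addrC; apply/eqP; apply: etrans fz0.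
  rewrite (horner_coef_wide _ size_f) big_ord_recr /= coef_map; congr (_ + _).
  by apply: eq_bigr => i _; rewrite coef_map.
suff: `|z| ^+ m <= \sum_(i < m) `|z| ^+ i.
  by move/(lt_le_trans (geo m)); rewrite ltxx.
rewrite -[leLHS]mul1r -lead1 -normrX -normrM zm_eq normrN.
apply: le_trans (ler_norm_sum _ _ _) _; apply: ler_sum => i _.
by rewrite normrM normrX ler_piMl ?exprn_ge0.
Qed.

(** Bernoulli's inequality: 1 + k (|z| - 1) <= |z|^k, which is unbounded in k
    when |z| > 1. *)
Lemma norm_le1_of_powers (z : algC) :
  (forall k, (0 < k)%N -> `|z| ^+ k < 2) -> `|z| <= 1.
Proof.
move=> zk_lt2; rewrite real_leNgt ?normr_real ?real1 //; apply/negP => z_gt1.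
have bern k : 1 + k%:R * (`|z| - 1) <= `|z| ^+ k.
  elim: k => [|k IHk]; first by rewrite mul0r addr0.
  rewrite exprS; apply: le_trans (ler_wpM2l (normr_ge0 _) IHk).
  rewrite -subr_ge0 -natr1.
  have -> : `|z| * (1 + k%:R * (`|z| - 1)) - (1 + (k%:R + 1) * (`|z| - 1))
     = k%:R * (`|z| - 1) ^+ 2 by ring.
  by rewrite mulr_ge0 // exprn_ge0 // subr_ge0 ltW.
have d_gt0 : 0 < `|z| - 1 by rewrite subr_gt0.
pose k := Num.bound (`|z| - 1)^-1.
have k_gt : (`|z| - 1)^-1 < k%:R by apply: archi_boundP; rewrite invr_ge0 ltW.
have k_gt0 : (0 < k)%N by rewrite -(ltr0n algC) (lt_trans _ k_gt) ?invr_gt0.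
have := le_lt_trans (bern k) (zk_lt2 k k_gt0).
rewrite -[2%:R]/(1 + 1) ltrD2l -ltr_pdivlMr // div1r => /lt_trans/(_ k_gt).
by rewrite ltxx.
Qed.

(** The sequence L (X^i) satisfies the linear recurrence with characteristic
    roots rs.  Passing to q |-> L ((X - z) q) removes the root z; as |z| <= 1,
    the induction hypothesis bounds the increments of |L (X^i)|, and summing
    them raises the degree of the bound by one. *)
Lemma linear_recurrence_growth (rs : seq algC) (L : {poly algC} -> algC) :
  (forall (a : algC) (p q : {poly algC}), L (a *: p + q) = a * L p + L q) ->
  {in rs, forall z, `|z| <= 1} ->
  (forall i, L ((\prod_(z <- rs) ('X - z%:P)) * 'X^i) = 0) ->
  exists C K, forall i, `|L 'X^i| <= (C * i.+1 ^ K)%:R.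
Proof.
elim: rs L => [|z rs IHrs] L linL rs_le1 L0.
  exists 0%N, 0%N => i.
  by have := L0 i; rewrite big_nil mul1r => ->; rewrite normr0.
have z_le1 : `|z| <= 1 by apply: rs_le1; rewrite mem_head.
have [||i|C [K LC]] := IHrs (fun q => L (('X - z%:P) * q)).
- by move=> a p q; rewrite mulrDr -scalerAr linL.
- by move=> y y_rs; apply: rs_le1; rewrite in_cons y_rs orbT.
- by rewrite mulrA; have := L0 i; rewrite big_cons.
have step i : `|L 'X^(i.+1)| <= `|L 'X^i| + (C * i.+1 ^ K)%:R.
  have -> : L 'X^(i.+1) = L (('X - z%:P) * 'X^i) + z * L 'X^i.
    have -> : ('X - z%:P) * 'X^i = (- z) *: 'X^i + 'X^(i.+1).
      by rewrite mulrBl -exprS addrC scaleNr mul_polyC.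
    by rewrite linL mulNr addrAC addNr add0r.
  rewrite addrC (le_trans (ler_normD _ _)) // lerD ?LC // normrM.
  by rewrite ler_piMl.
pose D := Num.bound `|L 'X^0|.
have le_D : `|L 'X^0| <= D%:R by rewrite ltW ?archi_boundP.
have bound i : `|L 'X^i| <= (D + i * C * i.+1 ^ K)%:R.
  elim: i => [|i IHi]; first by rewrite !mul0n addn0.
  apply: le_trans (step i) _; apply: le_trans (lerD IHi (lexx _)) _.
  rewrite -natrD ler_nat -addnA leq_add2l -!mulnA addnC -mulSn.
  rewrite !leq_mul2l; case: (posnP K) => [->|K_gt0]; first by rewrite !orbT.
  by rewrite leq_exp2r // leqnSn !orbT.
exists (D + C)%N, K.+1 => i; apply: le_trans (bound i) _; rewrite ler_nat.
rewrite mulnDl leq_add //; first by rewrite leq_pmulr // expn_gt0.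
by rewrite -mulnA mulnCA leq_mul2l expnS leq_mul2r leqnSn !orbT.
Qed.

Lemma bounded_polys (d B : nat) :
  exists2 S : seq {poly int}, size S = ((2 * B).+1 ^ d)%N &
    forall q : {poly int}, (size q <= d)%N -> (forall i, `|q`_i| <= B%:Z) ->
      q \in S.
Proof.
(* Digits in [0, 2B], shifted by -B, run through the allowed coefficients. *)
pose h (f : {ffun 'I_d -> 'I_(2 * B).+1}) : {poly int} :=
  \sum_(i < d) ((f i)%:Z - B%:Z) *: 'X^i.
exists [seq h f | f <- enum {: {ffun 'I_d -> 'I_(2 * B).+1}}].
  by rewrite size_map -cardE card_ffun !card_ord.
move=> q le_qd q_le; apply/mapP.
exists [ffun i : 'I_d => inord `|q`_i + B%:Z|]; first by rewrite mem_enum.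
have {1}-> : q = \sum_(i < d) q`_i *: 'X^i.
  rewrite -poly_def; apply/polyP => i; rewrite coef_poly.
  by case: ltnP => // le_di; rewrite nth_default // (leq_trans le_qd).
apply: eq_bigr => i _; congr (_ *: _); rewrite ffunE.
have := q_le i; rewrite ler_norml => /andP[qi_ge qi_le].
by rewrite inordK; lia.
Qed.

(** Pseudo-division by a nonzero r of minimal degree in an ideal I leaves no
    remainder, so r divides a nonzero multiple of each element of I.  By Gauss's
    lemma its primitive part then divides the element itself. *)
Lemma ideal_primitive_divisor (I : {poly int} -> Prop) :
  (forall p q, I p -> I q -> I (p - q)) ->
  (forall p q : {poly int}, I p -> I (q * p)) ->
  (exists2 f : {poly int}, f != 0 & I f) ->
  exists r : {poly int}, [/\ r != 0, I r &
    forall q, I q -> exists s, q = zprimitive r * s].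
Proof.
move=> IB IM [f f_neq0 If].
have exP : exists n, `[< exists q : {poly int}, [/\ q != 0, I q & size q = n] >].
  by exists (size f); apply/asboolP; exists f.
case: (ex_minnP exP) => n /asboolP[r [r_neq0 Ir <-]] r_min.
exists r; split=> // q Iq.
have Im : I (q %% r).
  have -> : q %% r = (lead_coef r ^+ scalp q r)%:P * q - (q %/ r) * r.
    by rewrite mul_polyC Pdiv.Idomain.divp_eq addrC addKr.
  by apply: IB; apply: IM.
have [s ->] : {s | q = zprimitive r * s}; last by exists s.
apply: dvdpP_int; rewrite /dvdp; apply/negPn/negP => qr_neq0.
have : (size r <= size (q %% r)%R)%N.
  by apply: r_min; apply/asboolP; exists (q %% r).
by rewrite leqNgt ltn_modp r_neq0.
Qed.

(** * Growth of the pairs {0, g} *)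

(** Monomial bounds are cofinal among integer polynomial ones
    ([poly_growth_wrtP]) and are easier to multiply. *)
Definition poly_bounded (t : nat -> nat) :=
  exists C K, forall n, (0 < n)%N -> (t n <= C * n ^ K)%N.

Lemma root_norm_le1 (p : {poly int}) (z : algC) :
  (forall k, (0 < k)%N -> exists f s : {poly int},
     [/\ f != 0, small_poly f & f \Po 'X^k = p * s]) ->
  root (map_poly intr p) z -> `|z| <= 1.
Proof.
move=> p_dvd pz0; apply: norm_le1_of_powers => k k_gt0.
have [f [s [f_neq0 f_small fE]]] := p_dvd k k_gt0.
rewrite -normrX; apply: (norm_root_small_poly f_neq0 f_small).
have : root (map_poly intr (f \Po 'X^k)) z by rewrite fE rmorphM rootM pz0.
by rewrite map_comp_poly map_polyXn root_comp hornerXn.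
Qed.

(** Over the complex numbers, taking the j-th coefficient of the remainder modulo
    p is linear and kills the multiples of p, so its values on the X^i satisfy a
    recurrence with the roots of p as characteristic roots. *)
Lemma remainder_growth (p : {poly int}) :
  lead_coef p \is a GRing.unit ->
  (forall z : algC, root (map_poly intr p) z -> `|z| <= 1) ->
  exists C K, forall n (q : {poly int}), bit_poly q -> (size q <= n)%N ->
    forall j, `|(q %% p)`_j| <= (C * n ^ K)%:Z.
Proof.
move=> p_unit roots_le1.
have p_neq0 : p != 0.
  by apply: contraTneq p_unit => ->; rewrite lead_coef0 unitr0.
pose pC : {poly algC} := map_poly intr p.
have size_pC : size pC = size p by apply: size_map_inj_poly; [exact: intr_inj |].
have pC_neq0 : pC != 0 by rewrite -size_poly_eq0 size_pC size_poly_eq0.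
have [rs pCE] := closed_field_poly_normal pC.
have lc_neq0 : lead_coef pC != 0 by rewrite lead_coef_eq0.
pose L j (q : {poly algC}) := (q %% pC)`_j.
have linL j (a : algC) (q r : {poly algC}) :
    L j (a *: q + r) = a * L j q + L j r.
  by rewrite /L modpD modpZl coefD coefZ.
have L0 j : L j 0 = 0 by rewrite /L mod0p coef0.
have /choice[C /choice[K LCK]] : forall j, exists C K, forall i,
    `|L j 'X^i| <= (C * i.+1 ^ K)%:R.
  move=> j; apply: (linear_recurrence_growth (rs := rs)); first exact: linL.
    move=> z z_rs; apply: roots_le1; rewrite -/pC pCE rootZ //.
    by rewrite root_prod_XsubC.
  move=> i; apply: (mulfI lc_neq0); rewrite mulr0.
  have := linL j (lead_coef pC) (\prod_(z <- rs) ('X - z%:P) * 'X^i) 0.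
  rewrite L0 !addr0 => <-; rewrite scalerAl -pCE.
  by rewrite /L modp_mulr coef0.
pose d := size p.
exists (\sum_(j < d) C j)%N, (\sum_(j < d) K j).+1 => n q q01 le_qn j.
have [le_dj|lt_jd] := leqP d j.
  by rewrite nth_default ?normr0 // (leq_trans _ le_dj) // ltnW // ltn_modp.
have rem_coef : L j (map_poly intr q) = ((q %% p)`_j)%:~R.
  rewrite /L {1}(Pdiv.IdomainUnit.divp_eq p_unit q) rmorphD rmorphM /=.
  rewrite modpD modp_mull add0r modp_small ?coef_map //.
  by rewrite !size_map_inj_poly ?ltn_modp //; exact: intr_inj.
rewrite -(ler_int algC) intr_norm -rem_coef.
have -> : map_poly intr q = \sum_(i < n) (q`_i)%:~R *: 'X^i :> {poly algC}.
  rewrite -(poly_def n (fun i => (q`_i)%:~R)); apply/polyP => i.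
  rewrite coef_map coef_poly.
  by case: ltnP => // le_ni; rewrite nth_default // (leq_trans le_qn).
have -> : L j (\sum_(i < n) (q`_i)%:~R *: 'X^i) =
    \sum_(i < n) (q`_i)%:~R * L j 'X^i.
  elim/big_rec2: _ => [|i a b _ <-]; first exact: L0.
  by rewrite linL.
apply: le_trans (ler_norm_sum _ _ _) _.
apply: le_trans
  (_ : \sum_(i < n) ((\sum_(j < d) C j) * n ^ \sum_(j < d) K j)%:R <= _).
  apply: ler_sum => i _; apply: le_trans (_ : `|L j 'X^i| <= _).
    by rewrite normrM ler_piMl //; case: (q01 i) => ->; rewrite ?normr0 ?normr1.
  apply: le_trans (LCK j i) _; rewrite ler_nat.
  have le_sum (h : nat -> nat) : (h j <= \sum_(j < d) h j)%N.
    by rewrite (bigD1 (Ordinal lt_jd)) //= leq_addr.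
  apply: leq_mul; first exact: le_sum.
  apply: leq_trans (_ : (n ^ K j <= _)%N); last first.
    by rewrite leq_pexp2l ?le_sum // (leq_ltn_trans _ (ltn_ord i)).
  by case: (posnP (K j)) => [->//|Kj_gt0]; rewrite leq_exp2r.
by rewrite sumr_const card_ord -mulrnA -mulnA -expnSr.
Qed.

Section SingleElement.
Variables (G : zmodType) (phi : {additive G -> G}).

(** Pigeonhole: two distinct 0-1 sequences of length m give the same element of
    the trajectory, and f is the difference of the two polynomials. *)
Lemma small_relation (g : G) (k m : nat) : (0 < k)%N ->
  (tau phi [fset 0%R; g] (k * m) < 2 ^ m)%N ->
  exists f : {poly int}, [/\ f != 0, small_poly f &
    poly_act phi g (f \Po 'X^k) = 0].
Proof.
move=> k_gt0 tau_lt.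
pose b (c : m.-tuple bool) : {poly int} := \poly_(i < m) (nth false c i)%:Z.
pose h c := poly_act phi g (b c \Po 'X^k).
have b01 c : bit_poly (b c).
  move=> i; rewrite coef_poly; case: ifP => _; last by left.
  by case: (nth false c i); [right | left].
have hT c : h c \in trajectory phi [fset 0; g] (k * m).
  apply/mem_trajectory_pair; exists (b c \Po 'X^k); split=> //.
    move=> i; rewrite coef_comp_poly_Xn //; case: ifP => _; last by left.
    exact: b01.
  apply/leq_sizeP => i le_i; rewrite coef_comp_poly_Xn //; case: ifP => // k_i.
  by rewrite coef_poly ltnNge leq_divRL // mulnC le_i.
have /injectivePn[c [c' neq_cc' hE]] : ~~ injectiveb h.
  apply: contraL tau_lt => /injectiveP h_inj; rewrite -leqNgt.
  have : uniq [seq h c | c <- enum {: m.-tuple bool}].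
    by rewrite map_inj_uniq ?enum_uniq.
  move/uniq_leq_size => /(_ (trajectory phi [fset 0; g] (k * m))).
  rewrite size_map -cardE card_tuple card_bool; apply=> _ /mapP[c _ ->].
  exact: hT.
exists (b c - b c'); split.
- rewrite subr_eq0; apply: contra neq_cc' => /eqP bE.
  apply/eqP/val_inj/(@eq_from_nth _ false); rewrite !size_tuple // => i lt_im.
  have := congr1 (fun q : {poly int} => q`_i) bE; rewrite !coef_poly lt_im.
  by case: (nth _ _ _); case: (nth _ _ _).
- move=> i; rewrite coefB.
  by case: (b01 c i) => ->; case: (b01 c' i) => ->.
- by rewrite comp_polyB poly_actB -/(h c) -/(h c') hE subrr.
Qed.

(** Each q is congruent, modulo the annihilators f and r of g, to some s2 p + t.
    Here t is the remainder of q modulo p and has polynomially bounded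
    coefficients.  Since f = p e and r = N p, the quotient of q by p may be
    reduced modulo e and its coefficients modulo N, so that s2 ranges over a
    finite set independent of n. *)
Lemma poly_bounded_pair (g : G) :
  (forall k, (0 < k)%N ->
     exists m, (tau phi [fset 0%R; g] (k * m) < 2 ^ m)%N) ->
  poly_bounded (tau phi [fset 0; g]).
Proof.
move=> tau_lt.
have rel k : (0 < k)%N -> exists f : {poly int}, [/\ f != 0, small_poly f &
    poly_act phi g (f \Po 'X^k) = 0].
  by move=> k_gt0; have [m] := tau_lt k k_gt0; apply: small_relation.
have [f [f_neq0 f_small]] := rel 1%N isT; rewrite comp_polyXr => f_ann.
have [|||r [r_neq0 r_ann p_dvd]] :=
  @ideal_primitive_divisor (fun q => poly_act phi g q = 0).
- by move=> p q p0 q0; rewrite poly_actB p0 q0 subrr.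
- by move=> p q; apply: poly_act_ann.
- by exists f.
pose p := zprimitive r; pose N := zcontents r.
have [e fE] := p_dvd f f_ann.
have f_unit : lead_coef f \is a GRing.unit.
  have := f_small (size f).-1; rewrite -lead_coefE => lf_le1.
  have := f_neq0; rewrite -lead_coef_eq0 => lf_neq0.
  have [->|->] : lead_coef f = 1 \/ lead_coef f = - 1 by lia.
    exact: unitr1.
  by rewrite unitrN unitr1.
move: (f_unit); rewrite fE lead_coefM unitrM => /andP[p_unit e_unit].
have N_neq0 : N != 0 by rewrite zcontents_eq0.
have e_neq0 : e != 0.
  by apply: contraTneq e_unit => ->; rewrite lead_coef0 unitr0.
have [|C [K rem_le]] := remainder_growth p_unit.
  move=> z; apply: root_norm_le1 => k k_gt0.
  have [fk [fk_neq0 fk_small fk_ann]] := rel k k_gt0.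
  by have [s fkE] := p_dvd _ fk_ann; exists fk, s.
have [S1 size_S1 S1P] := bounded_polys (size e) `|N|.
exists ((2 * `|N|).+1 ^ size e * (2 * C).+1 ^ size p)%N.
exists (K * size p)%N => n n_gt0.
have [S2 size_S2 S2P] := bounded_polys (size p) (C * n ^ K).
have sub : {subset trajectory phi [fset 0; g] n <=
    [seq poly_act phi g (s * p + t) | s <- S1, t <- S2]}.
  move=> _ /mem_trajectory_pair[q [q01 le_qn ->]].
  pose t := q %% p; pose s := (q %/ p) %% e.
  pose s1 := \poly_(i < size s) (s`_i %/ N)%Z.
  pose s2 := \poly_(i < size s) (s`_i %% N)%Z.
  have sE : s = N *: s1 + s2.
    apply/polyP => i; rewrite coefD coefZ !coef_poly mulrC.
    case: ltnP => [_|le_i]; first exact: divz_eq.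
    by rewrite mul0r addr0 nth_default.
  have qE : q = (q %/ p %/ e) * f + s1 * r + (s2 * p + t).
    rewrite {1}(Pdiv.IdomainUnit.divp_eq p_unit q) addrA; congr (_ + _).
    rewrite {1}(Pdiv.IdomainUnit.divp_eq e_unit (q %/ p)) -/s {1}sE.
    rewrite [in s1 * r](zpolyEprim r) -/p -/N fE -/p -!mul_polyC; ring.
  apply/allpairsP; exists (s2, t); split=> /=.
  - apply: S1P.
      apply: leq_trans (size_poly _ _) _; apply: ltnW; rewrite ltn_modp.
      exact: e_neq0.
    move=> i; rewrite coef_poly; case: ifP => _; last by rewrite normr0.
    by have := modz_ge0 s`_i N_neq0; have := ltz_mod s`_i N_neq0; lia.
  - apply: S2P; last exact: rem_le.
    by apply: ltnW; rewrite ltn_modp zprimitive_eq0.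
  - rewrite {1}qE !poly_actD.
    by rewrite !(poly_act_ann _ f_ann, poly_act_ann _ r_ann) !add0r.
apply: leq_trans (uniq_leq_size (fset_uniq _) sub) _.
rewrite size_allpairs size_S1 size_S2 -mulnA leq_mul2l expnM -expnMn.
apply/orP; right; case: (posnP (size p)) => [->//|p_gt0]; rewrite leq_exp2r //.
by rewrite [leqRHS]mulSn mulnA -add1n leq_add2r expn_gt0 n_gt0.
Qed.

End SingleElement.

(** * Polynomial growth of all finite sets *)

(** F is contained in the sum of the pairs {0, g} for g in F, and the trajectory
    of a sum is the sum of the trajectories. *)
Lemma poly_bounded_all (G : zmodType) (phi : {additive G -> G}) :
  (forall g, poly_bounded (tau phi [fset 0; g])) ->
  forall F : {fset G}, poly_bounded (tau phi F).
Proof.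
move=> pairs F.
have cover (s : seq G) : exists A : {fset G},
    [/\ 0 \in A, {subset s <= A} & poly_bounded (tau phi A)].
  elim: s => [|g s [A [A0 sA [C [K A_le]]]]].
    by exists [fset 0; 0]; split; [rewrite !inE eqxx | | exact: pairs].
  have [D [J g_le]] := pairs g.
  exists (sumset [fset 0; g] A); split.
  - by apply/sumsetP; exists 0, 0; split; rewrite ?addr0 // !inE eqxx.
  - move=> x; rewrite in_cons => /orP[/eqP->|/sA xA]; apply/sumsetP.
      by exists g, 0; split; rewrite ?addr0 // !inE eqxx orbT.
    by exists 0, x; split; rewrite ?add0r // !inE eqxx.
  - exists (D * C)%N, (J + K)%N => n n_gt0.
    apply: leq_trans (tau_sumset _ _ _ _) _; rewrite expnD mulnACA.
    by apply: leq_mul; [apply: g_le | apply: A_le].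
have [A [_ sFA [C [K A_le]]]] := cover (enum_fset F).
by exists C, K => n n_gt0; apply: leq_trans (leq_tau _ _ sFA) (A_le n n_gt0).
Qed.

Lemma poly_growth_wrtP (G : zmodType) (phi : {additive G -> G}) (F : {fset G}) :
  poly_growth_wrt phi F <-> poly_bounded (tau phi F).
Proof.
split=> [[P P_ge]|[C [K tau_le]]]; last first.
  exists (C%:Z *: 'X^K) => n n_gt0; rewrite hornerZ hornerXn.
  by rewrite -[C%:Z]natz -[n%:Z]natz -natrX -natrM natz lez_nat tau_le.
exists (\sum_(i < size P) `|(P`_i)%R|)%N, (size P) => n n_gt0.
rewrite -lez_nat; apply: le_trans (P_ge n n_gt0) _.
rewrite horner_coef big_distrl /= -[leRHS]natz natr_sum; apply: ler_sum => i _.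
apply: le_trans (ler_norm _) _; rewrite normrM natrM natz abszE.
rewrite ler_wpM2l // -[n%:Z]natz -natrX normr_nat !natz lez_nat.
by rewrite leq_pexp2l // ltnW.
Qed.

(** * Growth rates and entropy *)

Section Growth.
Variable R : realType.

(** Fekete's lemma: the limit is the infimum of the quotients.  If m nearly
    realizes the infimum, Euclidean division of n by m gives
    u n <= (n / m) u m + C, where C bounds the values of u below m. *)
Lemma fekete (u : nat -> R) :
  (forall m n, u (m + n)%N <= u m + u n) -> (forall n, 0 <= u n) ->
  cvgn (fun n => u n / n%:R).
Proof.
move=> u_sub u_ge0.
have uM k m : u (k.+1 * m)%N <= k.+1%:R * u m.
  elim: k => [|k IHk]; first by rewrite !mul1n mul1r.
  rewrite mulSn (le_trans (u_sub _ _)) // [in leRHS]mulrS mulrDl mul1r.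
  by rewrite lerD2l.
pose S := [set u n / n%:R | n in [set n | (0 < n)%N]].
have S_inf : has_inf S.
  split; first by exists (u 1%N / 1%:R); exists 1%N.
  by exists 0 => _ [n _ <-]; rewrite divr_ge0.
apply/cvg_ex; exists (inf S); apply/cvgrPdist_lt => e e_gt0.
have e2_gt0 : 0 < e / 2 by rewrite divr_gt0.
have [_ [m /= m_gt0 <-] um_lt] := inf_adherent e2_gt0 S_inf.
pose C := \sum_(r < m) u r.
have C_ge r : (r < m)%N -> u r <= C.
  move=> lt_rm; rewrite /C (bigD1 (Ordinal lt_rm)) //= lerDl.
  by apply: sumr_ge0 => i _.
(* Beyond this index C / n is less than e / 2. *)
exists (maxn m (Num.bound (C / (e / 2)))).+1 => // n /=; rewrite gtn_max.
case/andP => lt_mn lt_bn; have n_gt0 : (0 < n)%N by apply: leq_trans lt_mn.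
have nR_gt0 : 0 < n%:R :> R by rewrite ltr0n.
have mR_gt0 : 0 < m%:R :> R by rewrite ltr0n.
have inf_le : inf S <= u n / n%:R.
  by apply: ge_inf; [case: S_inf | exists n].
rewrite ler0_norm ?subr_le0 // opprB ltrBlDr.
have C_lt : C / n%:R < e / 2.
  rewrite ltr_pdivrMr // mulrC -ltr_pdivrMr //.
  have C_ge0 : 0 <= C by apply: sumr_ge0.
  apply: lt_le_trans (archi_boundP _) _; first by rewrite divr_ge0 // ltW.
  by rewrite ler_nat ltnW.
suff un_le : u n / n%:R <= u m / m%:R + C / n%:R.
  apply: le_lt_trans un_le _; apply: lt_le_trans (ltrD um_lt C_lt) _.
  by rewrite -addrA -splitr addrC.
have u_n : u n <= (n %/ m)%:R * u m + C.
  rewrite {1}(divn_eq n m) (le_trans (u_sub _ _)) // lerD //.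
    have : (0 < n %/ m)%N by rewrite divn_gt0 // ltnW.
    by case: (n %/ m)%N.
  by apply: C_ge; rewrite ltn_mod.
rewrite ler_pdivrMr // mulrDl divfK ?gt_eqF //; apply: le_trans u_n _.
rewrite lerD2r mulrC -mulrA ler_wpM2l // mulrC ler_pdivlMr //.
by rewrite -natrM ler_nat leq_trunc_div.
Qed.

(** The elementary estimate ln n <= 2 sqrt n makes ln (C n^K) / n at most
    ln C / n + 2 K / sqrt n. *)
Lemma poly_bounded_cvg0 (t : nat -> nat) : (forall n, (0 < t n)%N) ->
  poly_bounded t -> ln ((t n)%:R : R) / n%:R @[n --> \oo] --> (0 : R).
Proof.
move=> t_gt0 [C [K t_le]].
have C_gt0 : (0 < C)%N.
  by have := t_le 1%N isT; rewrite exp1n muln1; apply: leq_trans.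
apply: (@squeeze_cvgr _ _ _ _ (fun=> 0)
  (fun n => ln C%:R * n%:R^-1 + (K%:R * 2) * (Num.sqrt n%:R)^-1)).
- exists 1%N => // n /= n_gt0.
  have nR_gt0 : 0 < n%:R :> R by rewrite ltr0n.
  have sn_gt0 : 0 < Num.sqrt (n%:R : R) by rewrite sqrtr_gt0.
  rewrite divr_ge0 ?ln_ge0 ?ler1n //=.
  rewrite ler_pdivrMr // mulrDl mulfVK ?gt_eqF //.
  rewrite -[X in _ * _^-1 * X](sqr_sqrtr (ltW nR_gt0)) expr2 mulrA mulfVK ?gt_eqF //.
  have ln_n : ln (n%:R : R) <= 2 * Num.sqrt n%:R.
    rewrite -{1}(sqr_sqrtr (ltW nR_gt0)) lnXn // -[ln _ *+ 2]mulr_natl.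
    by rewrite ler_pM2l // ltW // ln_sublinear.
  have : ln ((t n)%:R : R) <= ln ((C * n ^ K)%:R).
    rewrite ler_ln ?posrE ?ltr0n ?ler_nat ?t_le //.
    by rewrite muln_gt0 C_gt0 expn_gt0 n_gt0.
  move/le_trans; apply; rewrite natrM lnM ?posrE ?ltr0n ?expn_gt0 ?n_gt0 //.
  rewrite lerD2l natrX lnXn // -[_ *+ K]mulr_natl -mulrA.
  by rewrite ler_wpM2l.
- exact: cvg_cst.
- have inv0 : (n%:R : R)^-1 @[n --> \oo] --> 0.
    rewrite -cvg_shiftS; exact: cvg_harmonic.
  rewrite -[0]addr0 -[X in X + _](mulr0 (ln C%:R)).
  rewrite -[X in _ + X](mulr0 (K%:R * 2)).
  apply: cvgD; first exact: cvgMr.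
  apply: cvgMr.
  have -> : (fun n => (Num.sqrt (n%:R : R))^-1) =
      Num.sqrt \o (fun n : nat => (n%:R : R)^-1).
    by apply/funext => n /=; rewrite sqrtrV.
  rewrite -[X in _ --> X](@sqrtr0 R).
  apply: continuous_cvg => //; exact: sqrt_continuous.
Qed.
End Growth.

Section Entropy.
Variables (R : realType) (G : zmodType) (phi : {additive G -> G}).

Lemma entropy_wrt_cvg (F : {fset G}) : F != fset0 ->
  cvgn (fun n : nat => ln ((tau phi F n)%:R : R) / n%:R).
Proof.
move=> F_neq0; have t_gt0 n : 0 < (tau phi F n)%:R :> R.
  by rewrite ltr0n tau_gt0.
apply: (@fekete _ (fun n => ln ((tau phi F n)%:R : R))) => [m n|n].
  by rewrite -lnM ?posrE // ler_ln ?posrE ?mulr_gt0 // -natrM ler_nat tau_submul.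
by rewrite ln_ge0 // ler1n tau_gt0.
Qed.

(** Otherwise 2^m <= tau (k m) <= (tau m)^k for all m, and the entropy is at
    least ln 2 / k. *)
Lemma zero_entropy_lt (F : {fset G}) k : F != fset0 -> (0 < k)%N ->
  entropy_wrt R phi F <= 0 -> exists m, (tau phi F (k * m) < 2 ^ m)%N.
Proof.
move=> F_neq0 k_gt0 h_le0; apply: contrapT => /forallNP tau_ge.
have : ln 2 / k%:R <= entropy_wrt R phi F.
  apply: limr_ge; first exact: entropy_wrt_cvg.
  exists 1%N => // n /= n_gt0; have /negP := tau_ge n; rewrite -leqNgt => le_2n.
  have nR : 0 < n%:R :> R by rewrite ltr0n.
  have kR : 0 < k%:R :> R by rewrite ltr0n.
  rewrite ler_pdivrMr // mulrAC ler_pdivlMr //.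
  rewrite mulr_natr mulr_natr -!lnXn ?ltr0n ?tau_gt0 //.
  rewrite ler_ln ?posrE ?exprn_gt0 ?ltr0n ?tau_gt0 // -!natrX ler_nat.
  exact: leq_trans le_2n (tau_exp _ _ _ _).
move/le_trans/(_ h_le0); rewrite leNgt => /negP[].
by rewrite divr_gt0 ?ltr0n // ln_gt0 // ltr1n.
Qed.

Lemma poly_growth_entropy_wrt (F : {fset G}) : F != fset0 ->
  poly_growth_wrt phi F -> entropy_wrt R phi F = 0.
Proof.
move=> F_neq0 /poly_growth_wrtP tau_le; apply/cvg_lim => //.
by apply: poly_bounded_cvg0 => // n; apply: tau_gt0.
Qed.

Lemma entropy_wrt_le (F : {fset G}) : F != fset0 ->
  ((entropy_wrt R phi F)%:E <= entropy R phi)%E.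
Proof. by move=> F_neq0; apply: ereal_sup_ubound; exists F. Qed.

Lemma fset1_0_neq0 : [fset 0 : G] != fset0.
Proof. by apply/fset0Pn; exists 0; rewrite inE. Qed.

Lemma entropy_ge0 : (0 <= entropy R phi)%E.
Proof.
apply: le_trans (entropy_wrt_le fset1_0_neq0).
rewrite lee_fin; apply: limr_ge; first exact: entropy_wrt_cvg fset1_0_neq0.
exists 1%N => // n _; apply: divr_ge0 => //.
by rewrite ln_ge0 // ler1n tau_gt0 // fset1_0_neq0.
Qed.

Lemma entropy_eq0P : entropy R phi = 0%E <-> poly_growth phi.
Proof.
split=> [h0 F F_neq0|growth].
  apply/poly_growth_wrtP/poly_bounded_all => g.
  apply: poly_bounded_pair => k k_gt0.
  have pair_neq0 : [fset 0; g] != fset0.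
    by apply/fset0Pn; exists 0; rewrite !inE eqxx.
  apply: zero_entropy_lt => //.
  by have := entropy_wrt_le pair_neq0; rewrite h0 lee_fin.
apply/eqP; rewrite eq_le entropy_ge0 andbT.
apply: ge_ereal_sup => _ [F /= F_neq0 <-].
by rewrite poly_growth_entropy_wrt ?lexx //; apply: growth.
Qed.

End Entropy.

Theorem corollary6p12 (R : realType) (G : zmodType)
    (phi : {additive G -> G}) :
  (entropy R phi = 0%E <-> poly_growth phi) /\
  ((0 < entropy R phi)%E <->
     exists F : {fset G}, F != fset0 /\ ~ poly_growth_wrt phi F).
Proof.
split; first exact: entropy_eq0P.
have -> : (0 < entropy R phi)%E <-> ~ poly_growth phi.
  rewrite -(entropy_eq0P R) lt_neqAle entropy_ge0 andbT eq_sym.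
  by split=> /eqP.
split=> [|[F [F_neq0 nF]] growth]; last exact: nF (growth F F_neq0).
by move=> /existsNP[F /not_implyP]; exists F.
Qed.
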